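(* Let $r>0$. For $h>0$ let $R_h$ be the two-dimensional hyperbolic complete orthoscheme, in the projective disc model $\mathbb{D}$, with vertices $P_0=(r,0)$, $P_1=(0,0)$, $P_2=(0,h)$, and let $A(h)$ be its hyperbolic area. Then: (1) If $r<1$, the area $A(h)$ attains its maximum over $h>0$ only at $h=1$, and the maximal area is $\pi/2-\alpha_1$, where $\alpha_1$ is the hyperbolic angle of $R_1$ at $P_0$. (2) If $r=1$, the area $A(h)$ attains its maximum at every $h\in[1,+\infty)$, and the maximal area is $\pi/2$. (3) If $r>1$, the area $A(h)$ attains its maximum at every $h\in[1, r/\sqrt{r^2-1}]$, and the maximal area is $\pi/2$.
   Context: The projective disc (Beltrami–Klein) model $\mathbb{D}$ of the hyperbolic plane is the open unit disc in $\mathbb{R}^2$, with hyperbolic lines the intersections of Euclidean lines with $\mathbb{D}$. Points on $\partial\mathbb{D}$ are ideal, points outside the closed disc ultraideal. An ultraideal point $v$ has a polar line: the hyperbolic line joining the two tangency points on $\partial\mathbb{D}$ of the tangent lines from $v$. Truncation of a Euclidean triangle at an ultraideal vertex $v$ means intersecting it with the closed half-plane bounded by the polar line of $v$ not containing $v$. The complete orthoscheme $R_h$ is the right-angled (at $P_1$) triangle $P_0P_1P_2$ intersected with $\mathbb{D}$, truncated at each of $P_0,P_2$ that is ultraideal; when both $P_0$ and $P_2$ are ultraideal and their polar lines intersect in $\mathbb{D}$, $R_h$ is the quadrilateral bounded by the edges $P_0P_1$, $P_1P_2$ and the two polar lines. *)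

(* Defs.v *)
From HB Require Import structures.
From mathcomp Require Import all_boot all_order all_algebra.
From mathcomp Require Import all_classical all_reals all_analysis.
Set Implicit Arguments. Unset Strict Implicit. Unset Printing Implicit Defensive.
Import Order.TTheory GRing.Theory Num.Theory.
Local Open Scope ring_scope.
Local Open Scope classical_set_scope.

Definition dot2 (R : realType) (p q : R * R) : R := p.1 * q.1 + p.2 * q.2.

Definition klein_disc (R : realType) : set (R * R) := [set p | dot2 p p < 1].

Definition triangle (R : realType) (a b c : R * R) : set (R * R) :=
  [set p | exists l0 l1 l2 : R, [/\ 0 <= l0, 0 <= l1, 0 <= l2, l0 + l1 + l2 = 1 &
     p = (l0 * a.1 + l1 * b.1 + l2 * c.1, l0 * a.2 + l1 * b.2 + l2 * c.2)]].

(* v is ultraideal iff it lies outside the closed unit disc. Its polar line is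
   {p | dot2 p v = 1} (the line through the two tangency points); the closed
   half-plane bounded by it not containing v is {p | dot2 p v <= 1}.
   Truncation at v (only performed when v is ultraideal). *)
Definition truncate_at (R : realType) (v : R * R) (S : set (R * R)) : set (R * R) :=
  if 1 < dot2 v v then S `&` [set p | dot2 p v <= 1] else S.

Definition P0 (R : realType) (r : R) : R * R := (r, 0).
Definition P1 (R : realType) : R * R := (0, 0).
Definition P2 (R : realType) (h : R) : R * R := (0, h).

Definition orthoscheme (R : realType) (r h : R) : set (R * R) :=
  truncate_at (P2 h) (truncate_at (P0 r)
    (triangle (P0 r) (@P1 R) (P2 h) `&` @klein_disc R)).

(* Hyperbolic area element of the Klein model: dx dy / (1 - x^2 - y^2)^(3/2). *)
Definition klein_density (R : realType) (p : R * R) : R :=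
  (Num.sqrt (1 - dot2 p p) ^+ 3)^-1.

Definition hyp_area (R : realType) (S : set (R * R)) : \bar R :=
  (\int[(@lebesgue_measure R \x @lebesgue_measure R)%E]_(p in S)
      (klein_density p)%:E)%E.

Definition A (R : realType) (r h : R) : \bar R := hyp_area (orthoscheme r h).

(* Riemannian metric of the Klein model at p (|p| < 1) on tangent vectors u v. *)
Definition klein_metric (R : realType) (p u v : R * R) : R :=
  dot2 u v / (1 - dot2 p p) + dot2 p u * dot2 p v / (1 - dot2 p p) ^+ 2.

Definition klein_angle (R : realType) (p u v : R * R) : R :=
  acos (klein_metric p u v / Num.sqrt (klein_metric p u u * klein_metric p v v)).

Definition angle_at_P0 (R : realType) (r h : R) : R :=
  klein_angle (P0 r) ((@P1 R).1 - (P0 r).1, (@P1 R).2 - (P0 r).2)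
                     ((P2 h).1 - (P0 r).1, (P2 h).2 - (P0 r).2).

(* Main.v *)
Require Import Defs.
From HB Require Import structures.
From mathcomp Require Import all_boot all_order all_algebra.
From mathcomp Require Import all_classical all_reals all_analysis.
From mathcomp Require Import measurable_realfun ring lra.
Import Order.TTheory GRing.Theory Num.Theory.
Import numFieldNormedType.Exports.
Local Open Scope classical_set_scope.
Local Open Scope ring_scope.

(** In coordinates, [orthoscheme r h] is the part of the disc with [x, y >= 0],
    [x / r + y / h <= 1], [r x <= 1] if [1 < r] and [h y <= 1] if [1 < h]; this is
    symmetric in [r] and [h], hence so is the area. By Tonelli, the part of the
    first quadrant below a line [y = h - m x] and between two verticals has area
    [W b - W a] for an explicit arcsine [W], which extends continuously to the ideal
    points of the boundary. Every orthoscheme is one such strip, or two of them when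
    both [P0] and [P2] are truncated and the edge [P0 P2] meets the disc; there
    the two arcsines at the common vertical are complementary, since the edge is
    orthogonal to the polar line of [P2].
    For [r < 1] the area increases with the region up to [h = 1], strictly because
    the integrands are strictly ordered; for [h > 1] it is the decreasing function
    [asin ((r / h) / sqrt (1 - r^2 + (r / h)^2))]. *)

(** * Limits of the arcsine and an improper fundamental theorem of calculus *)

(** [asin] inverts a continuous function on a segment, so it is continuous within [-1, 1]. Keeping
    [u] in that interval near the limit is what makes the endpoints 1 and -1 available; they are the
    values taken at ideal corners. *)
Lemma cvg_asin (R : realType) (T : Type) (F : set_system T) (FF : Filter F)
    (u : T -> R) (l : R) :
  -1 <= l <= 1 -> (\forall x \near F, -1 <= u x <= 1) ->
  u x @[x --> F] --> l -> asin (u x) @[x --> F] --> asin l.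
Proof.
move=> l1 u1 ul.
have c : {within `[(-1 : R), 1], continuous (@asin R)}.
  rewrite -[1 in X in `[_, X]]sin_pihalf -[X in `[-X, _]](@sin_pihalf R) -sinN.
  apply: (@segment_can_le_continuous R _ _ (@sin R)).
  - by have := @pi_gt0 R; lra.
  - by apply: continuous_subspaceT => x; exact: continuous_sin.
  - exact: sinK.
move/subspace_continuousP: c => /(_ l); rewrite /= in_itv/= => /(_ l1) c.
apply: cvg_trans c => A; rewrite /nbhs /= /within /= => A1.
have := ul _ A1; rewrite /nbhs /= => A2.
apply: filterS2 u1 A2 => x ux; apply; by rewrite in_itv.
Qed.

(** The usual theorem applies on compact subintervals exhausting the open one; monotone convergence
    handles the integrals and the one-sided limits of [F] the primitives. Nothing bounds [f] near
    [a] and [b], because the strip integrands can blow up at an ideal corner. *)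
Lemma ge0_improper_FTC2 (R : realType) (f F : R -> R) (a b : R) : a < b ->
  (forall x, x \in `]a, b[ -> 0 <= f x) ->
  {in `]a, b[, continuous f} ->
  (forall x, x \in `]a, b[ -> is_derive x 1 F (f x)) ->
  F x @[x --> a^'+] --> F a -> F x @[x --> b^'-] --> F b ->
  (\int[lebesgue_measure]_(x in `]a, b[) (f x)%:E = (F b - F a)%:E)%E.
Proof.
move=> ab f0 cf dF Fa Fb.
(* The factor 1/3 keeps [d n] below half the length already at [n = 0], so no interval [I n]
   degenerates. *)
pose d n : R := (b - a) / 3 * n.+1%:R^-1.
have d0 n : 0 < d n by rewrite mulr_gt0 ?invr_gt0 ?divr_gt0 ?subr_gt0.
have d2 n : d n < (b - a) / 2.
  apply: (@le_lt_trans _ _ ((b - a) / 3)); last by lra.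
  by rewrite /d ger_pMr ?divr_gt0 ?subr_gt0// invf_le1// ler1n.
have dd n m : (n <= m)%N -> d m <= d n.
  by move=> nm; rewrite /d ler_pM2l ?divr_gt0 ?subr_gt0// lef_pV2 ?posrE// ler_nat.
have d_0 : d n @[n --> \oo] --> (0 : R).
  rewrite -[X in _ --> X](mulr0 ((b - a) / 3)); apply: cvgMr.
  exact: cvg_harmonic.
clearbody d.
pose I n : set R := `[a + d n, b - d n]%classic.
have sub n x : I n x -> x \in `]a, b[.
  rewrite /I /= !in_itv/= => /andP[? ?].
  by have ? := d0 n; have ? := d2 n; apply/andP; split; lra.
have -> : `]a, b[%classic = \bigcup_n I n.
  apply/seteqP; split => x; last by move=> [n _] /sub.
  rewrite /= in_itv/= => /andP[ax xb].
  have e0 : 0 < Num.min (x - a) (b - x) by rewrite lt_min !subr_gt0 ax xb.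
  have [n _ dn] := (cvgr_lt _ d_0 _ e0).
  exists n => //; have := dn n (leqnn n); rewrite /= lt_min => /andP[? ?].
  by rewrite /I/= in_itv/=; apply/andP; split; lra.
have mf1 : measurable_fun `]a, b[%classic f.
  by apply: open_continuous_measurable_fun => // x; rewrite inE => /cf.
have mf n : measurable_fun (I n) (fun x => (f x)%:E).
  by apply/measurable_EFinP; apply: measurable_funS mf1 => // x /sub.
have cF x : x \in `]a, b[ -> {for x, continuous F}.
  by move=> /dF[+ _] => /derivable1_diffP/differentiable_continuous.
have key n : (\int[lebesgue_measure]_(x in I n) (f x)%:E)%E =
    (F (b - d n) - F (a + d n))%:E.
  have adb : a + d n < b - d n by have ? := d2 n; lra.
  have wc g : (forall x, x \in `]a, b[ -> {for x, continuous g}) ->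
      {within I n, continuous (g : R -> R)}.
    move=> cg; apply: continuous_in_subspaceT => x; rewrite inE => /sub; exact: cg.
  have /(continuous_within_itvP _ adb)[_ Fr Fl] := wc F cF.
  rewrite (continuous_FTC2 adb (F := F))//.
  - exact: wc.
  - split => // x xI; have /sub/dF[] : I n x by apply: subset_itv_oo_cc; exact: xI.
    by [].
  - move=> x xI; have /sub/dF[] : I n x by apply: subset_itv_oo_cc; exact: xI.
    by move=> _ <-; rewrite derive1E.
have : (\int[lebesgue_measure]_(x in I n) (f x)%:E)%E @[n --> \oo] -->
    (\int[lebesgue_measure]_(x in \bigcup_n I n) (f x)%:E)%E.
  apply: ge0_nondecreasing_set_cvg_integral => //.
  - move=> n m nm; apply/subsetPset/subset_itv; rewrite bnd_simp.
      by rewrite lerD2l dd.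
    by rewrite lerD2l lerN2 dd.
  - by move=> n; exact: measurable_itv.
  - by move=> n x /sub/f0; rewrite lee_fin.
move=> /cvg_lim <- //; apply/cvg_lim => //.
under eq_cvg do rewrite key.
apply: cvg_EFin; first exact: nearW.
apply: cvgB.
- move/cvg_at_leftP: Fb; apply; split.
    by move=> n; rewrite gtrBl.
  by rewrite -[X in _ --> X]subr0; apply: cvgB => //; exact: cvg_cst.
- move/cvg_at_rightP: Fa; apply; split.
    by move=> n; rewrite ltrDl.
  by rewrite -[X in _ --> X]addr0; apply: cvgD => //; exact: cvg_cst.
Qed.

(** * The density, the region in coordinates, and the symmetry of the area *)

Lemma measurable_klein_density (R : realType) :
  measurable_fun setT (@klein_density R).
Proof.
(* The inverse becomes a real power, which is measurable on the whole line. On and outside the unit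
   circle the root is 0 and both forms give 0. *)
have -> : @klein_density R = fun p =>
    (fun x => powR x (-1)) (Num.sqrt (1 - (p.1 * p.1 + p.2 * p.2)) ^+ 3).
  by apply/funext => p; rewrite powR_inv1// exprn_ge0.
apply: (measurableT_comp (f := fun x : R => powR x (-1))) => //.
apply: measurable_funX.
apply: (measurableT_comp (f := fun x : R => Num.sqrt x)).
  by apply: continuous_measurable_fun; exact: sqrt_continuous.
apply: measurable_funB => //.
by apply: measurable_funD; apply: measurable_funM;
  solve [exact: measurable_fst|exact: measurable_snd].
Qed.

Lemma klein_density_ge0 (R : realType) (p : R * R) : 0 <= klein_density p.
Proof. by rewrite invr_ge0 exprn_ge0. Qed.

Lemma orthoschemeP (R : realType) (r h x y : R) : 0 < r -> 0 < h ->
  orthoscheme r h (x, y) <->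
  [/\ 0 <= x, 0 <= y, x / r + y / h <= 1, x * x + y * y < 1 &
      (1 < r -> x * r <= 1) /\ (1 < h -> y * h <= 1)].
Proof.
move=> r0 h0.
have tri : triangle (P0 r) (@P1 R) (P2 h) (x, y) <->
    [/\ 0 <= x, 0 <= y & x / r + y / h <= 1].
  split.
    move=> [l0 [l1 [l2 [l00 l10 l20 l1E]]]] [-> ->] /=.
    rewrite !mulr0 !addr0 !add0r; split; [exact: mulr_ge0 (ltW _)|exact: mulr_ge0 (ltW _)|].
    by rewrite !mulfK ?gt_eqF//; lra.
  (* The barycentric coordinates of [(x, y)] with respect to [P0], [P1], [P2]. *)
  move=> [x0 y0 xy]; exists (x / r), (1 - x / r - y / h), (y / h).
  split; [by rewrite divr_ge0// ltW|lra|by rewrite divr_ge0// ltW|lra|].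
  by congr pair => /=; field; rewrite ?gt_eqF// ?andbT.
have rr : (1 < dot2 (P0 r) (P0 r)) = (1 < r).
  by rewrite /dot2/= mulr0 addr0 -expr2 expr_gt1// ltW.
have hh : (1 < dot2 (P2 h) (P2 h)) = (1 < h).
  by rewrite /dot2/= mulr0 add0r -expr2 expr_gt1// ltW.
rewrite /orthoscheme /truncate_at rr hh /klein_disc.
case: (boolP (1 < r)) => r1; case: (boolP (1 < h)) => h1 /=;
  rewrite /dot2 /= ?mulr0 ?addr0 ?add0r; split.
all: try by move=> [[[/tri[? ? ?] ?] ?] ?].
all: try by move=> [[/tri[? ? ?] ?] ?].
all: try by move=> [/tri[? ? ?] ?].
all: by move=> [? ? ? ? [? ?]]; repeat (split; auto); apply/tri.
Qed.

Lemma measurable_orthoscheme (R : realType) (r h : R) : 0 < r -> 0 < h ->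
  measurable (orthoscheme r h).
Proof.
move=> r0 h0.
pose B (p : R * R) := [&& 0 <= p.1, 0 <= p.2, p.1 / r + p.2 / h <= 1,
  p.1 * p.1 + p.2 * p.2 < 1 &
  (~~ (1 < r) || (p.1 * r <= 1)) && (~~ (1 < h) || (p.2 * h <= 1))].
have -> : orthoscheme r h = B @^-1` [set true].
  apply/seteqP; split => -[x y] /=.
    move=> /(orthoschemeP _ _ _ _ _ r0 h0)[x0 y0 xy xy1 [xr yh]].
    apply/and5P; split => //=; apply/andP.
    by split; [case: ltP xr => //= _; exact|case: ltP yh => //= _; exact].
  move=> /and5P[/= x0 y0 xy xy1 /andP[xr yh]]; apply/orthoschemeP => //; split => //.
  by split => [r1|h1]; [move: xr|move: yh]; rewrite ?r1 ?h1.
rewrite -[_ @^-1` _]setTI.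
have m1 : measurable_fun setT (fun p : R * R => p.1) by exact: measurable_fst.
have m2 : measurable_fun setT (fun p : R * R => p.2) by exact: measurable_snd.
suff : measurable_fun setT B by apply.
rewrite /B; do ?[apply: measurable_and | apply: measurable_or];
  do ?[apply: measurable_fun_ler | apply: measurable_fun_ltr];
  do ?[apply: measurable_funD | apply: measurable_funM]; by [].
Qed.

(** Swapping coordinates exchanges the two regions and preserves the density, so integrating one
    side by Tonelli in each order gives the same iterated integral. This reduces truncation at [P2]
    alone to truncation at [P0] alone. *)
Lemma A_sym (R : realType) (r h : R) : 0 < r -> 0 < h -> A r h = A h r.
Proof.
move=> r0 h0; rewrite /A /hyp_area integral_mkcond [RHS]integral_mkcond.
have mE s t : 0 < s -> 0 < t ->
    measurable_fun setT ((fun p : R * R => (klein_density p)%:E) \_ (orthoscheme s t)).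
  move=> s0 t0; apply/(measurable_restrictT _ _).1; first exact: measurable_orthoscheme.
  apply: measurable_funTS; apply/measurable_EFinP; exact: measurable_klein_density.
have ge0 s t p : (0 <= ((fun p : R * R => (klein_density p)%:E) \_ (orthoscheme s t)) p)%E.
  by rewrite patchE; case: ifP => // _; rewrite lee_fin klein_density_ge0.
have := fubini_tonelli2 (m1 := lebesgue_measure) (m2 := lebesgue_measure)
  _ (mE _ _ h0 r0) (ge0 h r).
have := fubini_tonelli1 (m1 := lebesgue_measure) (m2 := lebesgue_measure)
  _ (mE _ _ r0 h0) (ge0 r h).
move=> -> ->.
apply: eq_integral => x _; apply: eq_integral => y _.
rewrite !patchE.
have -> : ((x, y) \in orthoscheme r h) = ((y, x) \in orthoscheme h r).
  apply/idP/idP; rewrite !inE => /orthoschemeP [//|//|? ? ? ? [? ?]];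
  by apply/orthoschemeP => //; split => //; rewrite addrC.
by rewrite /klein_density /dot2 /= [x * x + _]addrC.
Qed.

(** * Differentiation rules and the integral of the density along a vertical segment *)

Lemma is_derive_continuous (R : realType) (f : R -> R) (x df : R) :
  is_derive x 1 f df -> {for x, continuous f}.
Proof. by case=> /derivable1_diffP/differentiable_continuous. Qed.

Lemma is_derive_sqrt_comp (R : realType) (g : R -> R) (x dg : R) :
  0 < g x -> is_derive x 1 g dg ->
  is_derive x 1 (fun t => Num.sqrt (g t)) (dg / (2 * Num.sqrt (g x))).
Proof.
move=> gx0 g'; rewrite mulrC.
have s' := is_derive1_sqrt gx0.
exact: (is_derive1_comp s' g').
Qed.

Lemma is_derive_div (R : realType) (f g : R -> R) (x df dg : R) :
  g x != 0 -> is_derive x 1 f df -> is_derive x 1 g dg ->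
  is_derive x 1 (fun t => f t / g t) ((df * g x - f x * dg) / g x ^+ 2).
Proof.
move=> gx0 f' g'; have v' := is_deriveV gx0 g'.
apply: (is_derive_eq (is_deriveM f' v')).
by rewrite /GRing.scale /=; field.
Qed.

Lemma integral_klein_density_vertical (R : realType) (x Y : R) :
  0 < Y -> x * x + Y * Y < 1 ->
  (\int[lebesgue_measure]_(y in `[0%R, Y]) (klein_density (x, y))%:E =
   (Y / ((1 - x ^+ 2) * Num.sqrt (1 - x ^+ 2 - Y ^+ 2)))%:E)%E.
Proof.
move=> Y0 xY.
have pos (y : R) : y \in `[0, Y] -> 0 < 1 - x ^+ 2 - y ^+ 2.
  rewrite in_itv/= => /andP[y0 yY].
  have : y * y <= Y * Y by exact: ler_pM.
  by rewrite !expr2; lra.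
have x1 : 0 < 1 - x ^+ 2 by rewrite expr2; have := mulr_gt0 Y0 Y0; lra.
have s' (y : R) : y \in `[0, Y] ->
    is_derive y 1 (fun y : R => Num.sqrt (1 - x ^+ 2 - y ^+ 2))
      (- (2 * y) / (2 * Num.sqrt (1 - x ^+ 2 - y ^+ 2))).
  move=> /pos y1.
  have q' : is_derive y 1 (fun y : R => 1 - x ^+ 2 - y ^+ 2) (- (2 * y)).
    by apply: is_derive_eq; rewrite ?scaler0 /GRing.scale/=; ring.
  exact: (is_derive_sqrt_comp _ (fun y : R => 1 - x ^+ 2 - y ^+ 2) _ _ y1 q').
pose F (y : R) := y / ((1 - x ^+ 2) * Num.sqrt (1 - x ^+ 2 - y ^+ 2)).
have dF (y : R) : y \in `[0, Y] -> is_derive y 1 F (klein_density (x, y)).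
  move=> yY; have y1 := pos _ yY.
  have s0 : 0 < Num.sqrt (1 - x ^+ 2 - y ^+ 2) by rewrite sqrtr_gt0.
  have s2 : Num.sqrt (1 - x ^+ 2 - y ^+ 2) ^+ 2 = 1 - x ^+ 2 - y ^+ 2.
    by rewrite sqr_sqrtr// ltW.
  have i' : is_derive y 1 (fun y : R => y) 1 by exact: is_derive_id.
  have c' : is_derive y 1 (fun _ : R => 1 - x ^+ 2) 0 by exact: is_derive_cst.
  have cs' : is_derive y 1 (fun y : R => (1 - x ^+ 2) * Num.sqrt (1 - x ^+ 2 - y ^+ 2)) _ :=
    is_deriveM c' (s' _ yY).
  have g0 : (1 - x ^+ 2) * Num.sqrt (1 - x ^+ 2 - y ^+ 2) != 0.
    by rewrite mulf_neq0 ?gt_eqF.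
  apply: (is_derive_eq (is_derive_div _ _ (fun y : R => (1 - x ^+ 2) * Num.sqrt (1 - x ^+ 2 - y ^+ 2)) _ _ _ g0 i' cs')).
  rewrite /klein_density /dot2 /= -!expr2 opprD addrA /GRing.scale/=.
  move: s0 s2; set s := Num.sqrt _ => s0 s2.
  (* Eliminating [x] leaves an identity of rational functions in [s] and [y]. *)
  have -> : 1 - x ^+ 2 = s ^+ 2 + y ^+ 2 by rewrite s2; ring.
  have ? : s ^+ 2 + y ^+ 2 != 0 by rewrite gt_eqF// s2; move: x1; lra.
  by field; rewrite gt_eqF.
have wc (g : R -> R) : (forall y, y \in `[0, Y] -> {for y, continuous g}) ->
    {within `[0, Y], continuous g}.
  by move=> cg; apply: continuous_in_subspaceT => y; rewrite inE; exact: cg.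
have /(continuous_within_itvP _ Y0)[_ F0 FY] : {within `[0, Y], continuous F}.
  by apply: wc => y /dF /is_derive_continuous.
have kc (y : R) : y \in `[0, Y] -> {for y, continuous (fun y : R => klein_density (x, y))}.
  move=> yY; have y1 := pos _ yY.
  have s0 : Num.sqrt (1 - x ^+ 2 - y ^+ 2) ^+ 3 != 0.
    by rewrite expf_neq0// gt_eqF// sqrtr_gt0.
  have -> : (fun y : R => klein_density (x, y)) =
      fun y => (Num.sqrt (1 - x ^+ 2 - y ^+ 2) ^+ 3)^-1.
    by apply/funext => z; rewrite /klein_density /dot2 /= -!expr2 opprD addrA.
  have s3' : is_derive y 1 (fun y : R => Num.sqrt (1 - x ^+ 2 - y ^+ 2) ^+ 3) _ :=
    is_deriveX 3 (s' _ yY).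
  exact: (is_derive_continuous _ _ _ _ (@is_deriveV _
    (fun y : R => Num.sqrt (1 - x ^+ 2 - y ^+ 2) ^+ 3) _ _ _ s0 s3')).
rewrite (continuous_FTC2 Y0 (F := F)).
- by rewrite {2}/F mul0r sube0.
- exact: wc.
- by split => // y /subset_itv_oo_cc/dF[].
- by move=> y /subset_itv_oo_cc/dF[_ <-]; rewrite derive1E.
Qed.

(** * The area of a strip between two verticals, below a line *)

(** The inner Tonelli integral at abscissa [t]: the value of [integral_klein_density_vertical] for a
    segment of height [h - m t]. *)
Definition strip_density {R : realType} (h m t : R) : R :=
  (h - m * t) / ((1 - t ^+ 2) * Num.sqrt (1 - t ^+ 2 - (h - m * t) ^+ 2)).

(** The cosine of the interior hyperbolic angle at the upper right corner
    [(t, h - m t)] of the strip under the line [y = h - m x], left of [x = t]. *)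
Definition strip_sine {R : realType} (h m t : R) : R :=
  (h * t - m) / Num.sqrt ((1 - t ^+ 2) * (1 - h ^+ 2 + m ^+ 2)).

(** This is pi/2 minus the angle at the upper right corner. Verticals are orthogonal to the x-axis,
    so a difference of two values is the angle defect of the strip between them, as Gauss-Bonnet
    predicts. *)
Definition strip_area {R : realType} (h m t : R) : R := asin (strip_sine h m t).

(** The numerators agree by a polynomial identity. The first hypothesis says that the line crosses
    the open disc; then the sine stays in [-1, 1] exactly as long as the corner [(t, h - m t)] stays
    in the closed disc, with absolute value 1 at an ideal corner. *)
Lemma sqr_strip_sine (R : realType) (h m t : R) :
  0 < 1 - h ^+ 2 + m ^+ 2 -> 0 < 1 - t ^+ 2 ->
  1 - strip_sine h m t ^+ 2 =
    (1 - t ^+ 2 - (h - m * t) ^+ 2) / ((1 - t ^+ 2) * (1 - h ^+ 2 + m ^+ 2)).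
Proof.
move=> D0 t1; rewrite /strip_sine expr_div_n sqr_sqrtr ?mulr_ge0 ?ltW//.
by field; rewrite !gt_eqF.
Qed.

Lemma strip_sine_bound (R : realType) (h m t : R) :
  0 < 1 - h ^+ 2 + m ^+ 2 -> 0 < 1 - t ^+ 2 ->
  t * t + (h - m * t) * (h - m * t) <= 1 -> -1 <= strip_sine h m t <= 1.
Proof.
move=> D0 t1 tY; rewrite -ler_norml -(@expr_le1 _ 2)// real_normK ?num_real//.
rewrite -subr_ge0 sqr_strip_sine// divr_ge0 ?mulr_ge0 ?(ltW D0) ?(ltW t1)//.
by rewrite !expr2; lra.
Qed.

Lemma is_derive_strip_sine (R : realType) (h m t : R) :
  0 < 1 - h ^+ 2 + m ^+ 2 -> 0 < 1 - t ^+ 2 ->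
  is_derive t 1 (strip_sine h m)
   ((h - m * t) / ((1 - t ^+ 2) * Num.sqrt ((1 - t ^+ 2) * (1 - h ^+ 2 + m ^+ 2)))).
Proof.
move=> D0 t1.
have q0 : 0 < (1 - t ^+ 2) * (1 - h ^+ 2 + m ^+ 2) by rewrite mulr_gt0.
have s0 : 0 < Num.sqrt ((1 - t ^+ 2) * (1 - h ^+ 2 + m ^+ 2)) by rewrite sqrtr_gt0.
have s2 := sqr_sqrtr (ltW q0).
have q' : is_derive t 1 (fun t : R => (1 - t ^+ 2) * (1 - h ^+ 2 + m ^+ 2))
    (- (2 * t) * (1 - h ^+ 2 + m ^+ 2)).
  by apply: is_derive_eq; rewrite ?scaler0 /GRing.scale/=; ring.
have s' := is_derive_sqrt_comp _
  (fun t : R => (1 - t ^+ 2) * (1 - h ^+ 2 + m ^+ 2)) _ _ q0 q'.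
have n' : is_derive t 1 (fun t : R => h * t - m) h.
  by apply: is_derive_eq; rewrite ?scaler0 /GRing.scale/=; ring.
have s0' : Num.sqrt ((1 - t ^+ 2) * (1 - h ^+ 2 + m ^+ 2)) != 0 by rewrite gt_eqF.
apply: (is_derive_eq (is_derive_div _ _
  (fun t : R => Num.sqrt ((1 - t ^+ 2) * (1 - h ^+ 2 + m ^+ 2))) _ _ _ s0' n' s')).
move: s0 s0' s2; set s := Num.sqrt _ => s0 s0' s2.
(* Solving the defining equation of the root for this factor leaves a rational identity in [s]. *)
have DE : 1 - h ^+ 2 + m ^+ 2 = s ^+ 2 / (1 - t ^+ 2).
  by rewrite s2 mulrAC mulfV ?mul1r// gt_eqF.
by rewrite DE; field; rewrite s0' gt_eqF.
Qed.

Lemma is_derive_strip_area (R : realType) (h m t : R) :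
  0 < 1 - h ^+ 2 + m ^+ 2 -> t * t + (h - m * t) * (h - m * t) < 1 ->
  is_derive t 1 (strip_area h m) (strip_density h m t).
Proof.
move=> D0 tY.
have s0 : 0 < 1 - t ^+ 2 - (h - m * t) ^+ 2 by rewrite !expr2; lra.
have t1 : 0 < 1 - t ^+ 2.
  by apply: lt_le_trans s0 _; rewrite gerBl sqr_ge0.
have q0 : 0 < (1 - t ^+ 2) * (1 - h ^+ 2 + m ^+ 2) by rewrite mulr_gt0.
have u' := is_derive_strip_sine _ _ _ _ D0 t1.
have u1 : -1 < strip_sine h m t < 1.
  rewrite -ltr_norml -(@expr_lt1 _ 2)// real_normK ?num_real//.
  by rewrite -subr_gt0 sqr_strip_sine// divr_gt0.
apply: (is_derive_eq (is_derive1_comp (is_derive1_asin u1) u')).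
rewrite sqr_strip_sine// /strip_density sqrtrM ?(ltW s0)// sqrtrV ?(ltW q0)//.
by field; rewrite !gt_eqF ?sqrtr_gt0.
Qed.

Lemma continuous_strip_density (R : realType) (h m t : R) :
  t * t + (h - m * t) * (h - m * t) < 1 ->
  {for t, continuous (strip_density h m)}.
Proof.
move=> tY.
have s0 : 0 < 1 - t ^+ 2 - (h - m * t) ^+ 2 by rewrite !expr2; lra.
have t1 : 0 < 1 - t ^+ 2.
  by apply: lt_le_trans s0 _; rewrite gerBl sqr_ge0.
have q' : is_derive t 1 (fun t : R => 1 - t ^+ 2 - (h - m * t) ^+ 2)
    (2 * m * (h - m * t) - 2 * t).
  by apply: is_derive_eq; rewrite ?scaler0 /GRing.scale/=; ring.
have s' := is_derive_sqrt_comp _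
  (fun t : R => 1 - t ^+ 2 - (h - m * t) ^+ 2) _ _ s0 q'.
have c' : is_derive t 1 (fun t : R => 1 - t ^+ 2) (- (2 * t)).
  by apply: is_derive_eq; rewrite ?scaler0 /GRing.scale/=; ring.
have cs' : is_derive t 1 (fun t : R =>
  (1 - t ^+ 2) * Num.sqrt (1 - t ^+ 2 - (h - m * t) ^+ 2)) _ := is_deriveM c' s'.
have n' : is_derive t 1 (fun t : R => h - m * t) (- m).
  by apply: is_derive_eq; rewrite ?scaler0 /GRing.scale/=; ring.
have g0 : (1 - t ^+ 2) * Num.sqrt (1 - t ^+ 2 - (h - m * t) ^+ 2) != 0.
  by rewrite mulf_neq0 ?gt_eqF ?sqrtr_gt0.
exact: (is_derive_continuous _ _ _ _ (is_derive_div _ _ (fun t : R =>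
  (1 - t ^+ 2) * Num.sqrt (1 - t ^+ 2 - (h - m * t) ^+ 2)) _ _ _ g0 n' cs')).
Qed.

(** The corner above [e] may be ideal: [asin] is then not differentiable at the limit, but it is
    still continuous from within [-1, 1]. The condition on [e] avoids the zeros of the denominator
    of [strip_sine]. *)
Lemma cvg_strip_area (R : realType) (h m e : R) (F : set_system R) (FF : Filter F) :
  0 < 1 - h ^+ 2 + m ^+ 2 -> 0 < 1 - e ^+ 2 ->
  e * e + (h - m * e) * (h - m * e) <= 1 ->
  (\forall t \near F, t * t + (h - m * t) * (h - m * t) < 1) ->
  F --> e -> strip_area h m t @[t --> F] --> strip_area h m e.
Proof.
move=> D0 e1 eY tY Fe; apply: cvg_asin.
- exact: strip_sine_bound.
- apply: filterS tY => t tY; apply: strip_sine_bound => //; last exact: ltW.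
  by rewrite expr2; have := sqr_ge0 (h - m * t); rewrite expr2; lra.
- have /is_derive_continuous c := is_derive_strip_sine _ _ _ _ D0 e1.
  exact: cvg_comp Fe c.
Qed.

(** Tonelli, the vertical integral, then the improper fundamental theorem. Sections are prescribed
    over the open interval only, the two bounding verticals being null sets. The endpoint limits are
    hypotheses so that the ideal point (1, 0), where [strip_sine] is singular, can also be an end of
    the strip. *)
Lemma hyp_area_strip (R : realType) (S : set (R * R)) (a b h m : R) :
  measurable S -> a < b ->
  (forall x y, S (x, y) -> a <= x <= b) ->
  (forall x y, a < x < b -> S (x, y) <-> 0 <= y <= h - m * x) ->
  (forall x, a < x < b ->
    0 < h - m * x /\ x * x + (h - m * x) * (h - m * x) < 1) ->
  0 < 1 - h ^+ 2 + m ^+ 2 ->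
  strip_area h m x @[x --> a^'+] --> strip_area h m a ->
  strip_area h m x @[x --> b^'-] --> strip_area h m b ->
  hyp_area S = (strip_area h m b - strip_area h m a)%:E.
Proof.
move=> mS ab Sab SY Y1 D0 Wa Wb.
rewrite /hyp_area integral_mkcond.
have mE : measurable_fun setT ((fun p : R * R => (klein_density p)%:E) \_ S).
  apply/(measurable_restrictT _ _).1 => //.
  by apply: measurable_funTS; apply/measurable_EFinP; exact: measurable_klein_density.
have ge0 p : (0 <= ((fun p : R * R => (klein_density p)%:E) \_ S) p)%E.
  by rewrite patchE; case: ifP => // _; rewrite lee_fin klein_density_ge0.
have := fubini_tonelli1 (m1 := lebesgue_measure) (m2 := lebesgue_measure) _ mE ge0.
move=> ->; rewrite /fubini_F.
have inner (x : R) : a < x < b ->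
    (\int[lebesgue_measure]_y ((fun p : R * R => (klein_density p)%:E) \_ S) (x, y) =
     (strip_density h m x)%:E)%E.
  move=> xab; have [Y0 Y2] := Y1 _ xab.
  rewrite -integral_klein_density_vertical// [RHS]integral_mkcond.
  apply: eq_integral => y _; rewrite !patchE.
  have -> // : ((x, y) \in S) = (y \in `[0, h - m * x]%classic).
  by apply/idP/idP; rewrite !inE /= in_itv/= => /SY; apply.
set phi := fun x : R => _.
have phiE (x : R) : x \in `]a, b[%classic -> phi x = (strip_density h m x)%:E.
  by rewrite inE /= in_itv/=; exact: inner.
(* Off [a, b] the sections of [S] are empty. *)
have -> : (\int[lebesgue_measure]_x phi x =
    \int[lebesgue_measure]_(x in `[a, b]) phi x)%E.
  rewrite [RHS]integral_mkcond; apply: eq_integral => x _; rewrite patchE.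
  case: ifPn => //; rewrite notin_setE /= in_itv/= => xab.
  rewrite /phi -[RHS](integral0 lebesgue_measure setT).
  apply: eq_integral => y _; rewrite patchE ifF//.
  by apply/negP; rewrite inE => /Sab.
have md : measurable_fun `]a, b[%classic (fun x => (strip_density h m x)%:E).
  apply/measurable_EFinP; apply: open_continuous_measurable_fun => // x.
  by rewrite inE /= in_itv/= => /Y1[_ ?]; exact: continuous_strip_density.
rewrite integral_itv_bndoo; last by apply: eq_measurable_fun md => x /phiE.
transitivity (\int[lebesgue_measure]_(x in `]a, b[) (strip_density h m x)%:E)%E.
  by apply: eq_integral => x /phiE.
apply: ge0_improper_FTC2 => // x; rewrite in_itv/= => xab; have [Y0 Y2] := Y1 _ xab.
- have := sqr_ge0 x; have := mulr_gt0 Y0 Y0; rewrite expr2 => ? ?.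
  rewrite divr_ge0 ?(ltW Y0)// mulr_ge0// subr_ge0 expr2; lra.
- exact: continuous_strip_density.
- exact: is_derive_strip_area.
Qed.

(** Strict convexity of the disc: along the line, one minus the squared norm is quadratic in [x]
    with leading coefficient [-(1 + m^2)], so it exceeds its linear interpolation between [a] and
    [b] by [(1 + m^2) (x - a) (b - x)]. *)
Lemma line_in_disc (R : realType) (a b h m x : R) :
  a * a + (h - m * a) * (h - m * a) <= 1 ->
  b * b + (h - m * b) * (h - m * b) <= 1 ->
  a < x < b -> x * x + (h - m * x) * (h - m * x) < 1.
Proof.
move=> aY bY /andP[ax xb].
have ab : 0 < b - a by lra.
have E : (1 - (x * x + (h - m * x) * (h - m * x))) * (b - a) =
    (1 - (a * a + (h - m * a) * (h - m * a))) * (b - x) +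
    (1 - (b * b + (h - m * b) * (h - m * b))) * (x - a) +
    (1 + m ^+ 2) * ((x - a) * (b - x) * (b - a)) by ring.
have : 0 < (1 - (x * x + (h - m * x) * (h - m * x))) * (b - a).
  rewrite E ltr_wpDl//.
    by rewrite addr_ge0// mulr_ge0; lra.
  apply: mulr_gt0; first by have := sqr_ge0 m; lra.
  by rewrite !mulr_gt0// subr_gt0.
by rewrite pmulr_lgt0// subr_gt0.
Qed.

Lemma continuous_strip_area (R : realType) (a b h m : R) :
  0 <= a -> a < b -> b < 1 ->
  a * a + (h - m * a) * (h - m * a) <= 1 ->
  b * b + (h - m * b) * (h - m * b) <= 1 ->
  0 < 1 - h ^+ 2 + m ^+ 2 ->
  {within `[a, b], continuous (strip_area h m)}.
Proof.
move=> a0 ab b1 aY bY D0.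
have sq (e : R) : 0 <= e -> e < 1 -> 0 < 1 - e ^+ 2.
  by move=> ? ?; rewrite subr_gt0 expr_lt1.
apply/(continuous_within_itvP _ ab); split.
- move=> x; rewrite in_itv/= => /(line_in_disc _ _ _ _ _ _ aY bY) xY.
  exact: is_derive_continuous (is_derive_strip_area _ _ _ _ D0 xY).
- apply: cvg_strip_area => //.
  + by apply: sq => //; exact: lt_trans b1.
  + near=> t; apply: line_in_disc aY bY _; apply/andP; split.
      by near: t; exact: nbhs_right_gt.
    by near: t; exact: nbhs_right_lt.
  + exact: cvg_within.
- apply: cvg_strip_area => //.
  + by apply: sq => //; apply/ltW; exact: le_lt_trans ab.
  + near=> t; apply: line_in_disc aY bY _; apply/andP; split.
      by near: t; exact: nbhs_left_gt.
    by near: t; exact: nbhs_left_lt.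
  + exact: cvg_within.
Unshelve. all: by end_near. Qed.

(** With [b < 1] the endpoint limits are automatic, and conditions at the two ends suffice because
    the height is affine and the disc convex. Height 0 is allowed at [b], where a triangle has its
    vertex [P0]. *)
Lemma hyp_area_strip_lt1 (R : realType) (S : set (R * R)) (a b h m : R) :
  measurable S -> 0 <= a -> a < b -> b < 1 ->
  (forall x y, S (x, y) -> a <= x <= b) ->
  (forall x y, a < x < b -> S (x, y) <-> 0 <= y <= h - m * x) ->
  0 < h - m * a -> 0 <= h - m * b ->
  a * a + (h - m * a) * (h - m * a) <= 1 ->
  b * b + (h - m * b) * (h - m * b) <= 1 ->
  0 < 1 - h ^+ 2 + m ^+ 2 ->
  hyp_area S = (strip_area h m b - strip_area h m a)%:E.
Proof.
move=> mS a0 ab b1 Sab SY Ya Yb aY bY D0.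
have := continuous_strip_area _ _ _ _ _ a0 ab b1 aY bY D0.
move=> /(continuous_within_itvP _ ab)[_ Wa Wb].
apply: hyp_area_strip => // x xab; split; last exact: line_in_disc xab.
move: xab => /andP[ax xb].
suff : 0 < (h - m * x) * (b - a) by rewrite pmulr_lgt0// subr_gt0.
have -> : (h - m * x) * (b - a) = (h - m * a) * (b - x) + (h - m * b) * (x - a) by ring.
by rewrite ltr_wpDr ?mulr_ge0 ?mulr_gt0//; lra.
Qed.

(** * Values and identities of the arcsine *)

Lemma asin_eq (R : realType) (x y : R) :
  -(pi / 2) <= y <= pi / 2 -> sin y = x -> asin x = y.
Proof. by move=> y1 <-; rewrite sinK// in_itv. Qed.

Lemma asin0 (R : realType) : asin (0 : R) = 0.
Proof. by apply: asin_eq; rewrite ?sin0//; have := @pi_gt0 R; lra. Qed.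

Lemma asin1 (R : realType) : asin (1 : R) = pi / 2.
Proof. by apply: asin_eq; rewrite ?sin_pihalf//; have := @pi_gt0 R; lra. Qed.

Lemma asinN (R : realType) (x : R) : -1 <= x <= 1 -> asin (- x) = - asin x.
Proof.
move=> x1; apply: asin_eq; last by rewrite sinN asinK.
by have := asin_geNpi2 x1; have := asin_lepi2 x1; lra.
Qed.

Lemma lt_asin (R : realType) (x y : R) :
  -1 <= x <= 1 -> -1 <= y <= 1 -> x < y -> asin x < asin y.
Proof.
move=> x1 y1; rewrite -{1}(asinK x1) -{1}(asinK y1).
by rewrite ltr_sin// in_itv/= asin_geNpi2// asin_lepi2.
Qed.

Lemma asin_acos (R : realType) (x : R) : -1 <= x <= 1 -> asin x = pi / 2 - acos x.
Proof.
move=> x1; apply: asin_eq; last by rewrite sinB sin_pihalf cos_pihalf acosK// mul0r mul1r subr0.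
by have := acos_ge0 x1; have := acos_lepi x1; have := @pi_gt0 R; lra.
Qed.

Lemma asinD_pihalf (R : realType) (x y : R) :
  0 <= x -> 0 <= y -> x ^+ 2 + y ^+ 2 = 1 -> asin x + asin y = pi / 2.
Proof.
move=> x0 y0 xy.
have x1 : -1 <= x <= 1.
  have : x <= 1 by rewrite -(@expr_le1 _ 2)// -xy lerDl sqr_ge0.
  by move=> ?; apply/andP; split; lra.
suff -> : asin y = pi / 2 - asin x by rewrite addrC subrK.
apply: asin_eq; last first.
  rewrite sinB sin_pihalf cos_pihalf mul0r mul1r subr0 cos_asin//.
  have -> : 1 - x ^+ 2 = y ^+ 2 by rewrite -xy addrAC subrr add0r.
  by rewrite sqrtr_sqr ger0_norm.
have a0 : 0 <= asin x.
  move: x0; rewrite le_eqVlt => /orP[/eqP <-|x0]; first by rewrite asin0.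
  rewrite -(asin0 R); apply/ltW/lt_asin => //.
  by rewrite lerN10 ler01.
by have := asin_lepi2 x1; have := @pi_gt0 R; lra.
Qed.

(** * The area of each shape of orthoscheme *)

Lemma below_hypotenuse (R : realType) (r h x y : R) : 0 < h ->
  (x / r + y / h <= 1) = (y <= h - h / r * x).
Proof.
move=> h0; rewrite -lerBrDl ler_pdivrMr//.
by congr (_ <= _); ring.
Qed.

Lemma hypotenuse_gt0 (R : realType) (r h : R) : 0 < r -> 0 < h -> h <= 1 ->
  0 < 1 - h ^+ 2 + (h / r) ^+ 2.
Proof.
move=> r0 h0 h1; rewrite ltr_wpDl ?exprn_gt0 ?divr_gt0//.
by rewrite subr_ge0 expr_le1// ltW.
Qed.

Lemma A_triangle (R : realType) (r h : R) : 0 < r -> r < 1 -> 0 < h -> h <= 1 ->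
  A r h = (strip_area h (h / r) r - strip_area h (h / r) 0)%:E.
Proof.
move=> r0 r1 h0 h1.
have hr : h / r * r = h by rewrite divfK ?gt_eqF.
have e0 : 0 * 0 + (h - h / r * 0) * (h - h / r * 0) <= 1.
  by rewrite !mulr0 add0r subr0 -expr2 expr_le1// ltW.
have e1 : r * r + (h - h / r * r) * (h - h / r * r) <= 1.
  by rewrite hr subrr mulr0 addr0 -expr2 expr_le1// ltW.
apply: hyp_area_strip_lt1 => //.
- exact: measurable_orthoscheme.
- move=> x y /orthoschemeP[//|//|-> y0 xy _ _] /=.
  by rewrite -[leRHS]mul1r -ler_pdivrMr// (le_trans _ xy)// lerDl divr_ge0// ltW.
- move=> x y xr; have q := line_in_disc _ _ _ _ _ _ e0 e1 xr; split.
    by move=> /orthoschemeP[//|//|_ -> xy _ _] /=; rewrite -below_hypotenuse.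
  move=> /andP[y0 yY]; apply/orthoschemeP => //; split => //.
  - by case/andP: xr => /ltW.
  - by rewrite below_hypotenuse.
  - by apply: le_lt_trans q; rewrite lerD2l ler_pM.
  - by split; [move/(lt_trans r1)|move/(le_lt_trans h1)]; rewrite ltxx.
- by rewrite mulr0 subr0.
- by rewrite hr subrr.
- exact: hypotenuse_gt0.
Qed.

(** The polar line [x = 1/r] of [P0] is orthogonal to the edge [P0 P2], so [strip_sine] vanishes at
    the right end and only the corner at [P2] contributes. *)
Lemma A_truncated_left (R : realType) (r h : R) : 1 < r -> 0 < h -> h <= 1 ->
  A r h = (asin (h / r / Num.sqrt (1 - h ^+ 2 + (h / r) ^+ 2)))%:E.
Proof.
move=> r1 h0 h1.
have r0 : 0 < r by lra.
have rV0 : 0 < r^-1 by rewrite invr_gt0.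
have rV1 : r^-1 < 1 by rewrite invf_lt1.
have rV2 : r^-1 * r^-1 < 1 by rewrite mulr_ilt1// ltW.
have D0 := hypotenuse_gt0 _ _ _ r0 h0 h1.
have e0 : 0 * 0 + (h - h / r * 0) * (h - h / r * 0) <= 1.
  by rewrite !mulr0 add0r subr0 -expr2 expr_le1// ltW.
have Y1 : h - h / r * r^-1 = h * (1 - r^-1 * r^-1) by ring.
have Yb : 0 <= h - h / r * r^-1 by rewrite Y1 mulr_ge0 ?ltW// subr_gt0.
have e1 : r^-1 * r^-1 + (h - h / r * r^-1) * (h - h / r * r^-1) <= 1.
  (* With [z = 1/r^2] the corner has height at most [1 - z], and [z + (1 - z)^2 <= 1] for [z] in
     [0, 1]. *)
  have Yle : h - h / r * r^-1 <= 1 - r^-1 * r^-1.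
    by rewrite Y1 ger_pMl// subr_gt0.
  have := ler_pM Yb Yb Yle Yle; set z := r^-1 * r^-1 in rV2 *.
  have : 0 < z by rewrite mulr_gt0.
  nra.
have AE : A r h = (strip_area h (h / r) r^-1 - strip_area h (h / r) 0)%:E.
  apply: hyp_area_strip_lt1 => //.
  - exact: measurable_orthoscheme.
  - move=> x y /orthoschemeP[//|//|-> y0 xy _ [/(_ r1) xr _]] /=.
    by rewrite -[r^-1]mul1r ler_pdivlMr.
  - move=> x y xr; have q := line_in_disc _ _ _ _ _ _ e0 e1 xr; split.
      by move=> /orthoschemeP[//|//|_ -> xy _ _] /=; rewrite -below_hypotenuse.
    move=> /andP[y0 yY]; apply/orthoschemeP => //; split => //.
    + by case/andP: xr => /ltW.
    + by rewrite below_hypotenuse.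
    + by apply: le_lt_trans q; rewrite lerD2l ler_pM.
    + split; last by move/(le_lt_trans h1); rewrite ltxx.
      by rewrite -ler_pdivlMr// mul1r => _; case/andP: xr => _ /ltW.
  - by rewrite mulr0 subr0.
rewrite AE /strip_area /strip_sine subrr mul0r asin0 sub0r mulr0 sub0r.
rewrite expr0n subr0 mul1r mulNr asinN ?opprK//.
have z1 : 0 < 1 - 0 ^+ 2 :> R by rewrite expr0n subr0.
have := strip_sine_bound _ _ _ _ D0 z1 e0.
rewrite /strip_sine mulr0 sub0r expr0n subr0 mul1r mulNr.
by rewrite lerN2 lerNl andbC.
Qed.

(** Here the strip ends at the ideal point (1, 0), where [strip_sine] is 0/0. Division by zero gives
    it the value 0, which is also its left limit, so the general strip formula applies once this
    limit is checked by hand. *)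
Lemma A_ideal_ideal (R : realType) : A (1 : R) 1 = (pi / 2)%:E.
Proof.
have D0 := hypotenuse_gt0 R 1 1 ltr01 ltr01 (lexx 1).
have e0 : 0 * 0 + (1 - 1 / 1 * 0) * (1 - 1 / 1 * 0) <= 1 :> R.
  by rewrite !mulr0 add0r subr0 mulr1.
have e1 : 1 * 1 + (1 - 1 / 1 * 1) * (1 - 1 / 1 * 1) <= 1 :> R.
  by rewrite divr1 !mulr1 subrr mulr0 addr0.
have u1 : strip_sine 1 (1 / 1) 1 = 0 :> R.
  by rewrite /strip_sine divr1 mulr1 subrr mul0r.
have AE : A 1 1 = (strip_area 1 (1 / 1) 1 - strip_area 1 (1 / 1) 0 : R)%:E.
  apply: hyp_area_strip => //.
  - exact: measurable_orthoscheme.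
  - move=> x y /orthoschemeP[//|//|-> y0 xy _ _] /=.
    by move: xy; rewrite !divr1; lra.
  - move=> x y xr; have q := line_in_disc _ _ _ _ _ _ e0 e1 xr; split.
      by move=> /orthoschemeP[//|//|_ -> xy _ _] /=; rewrite -below_hypotenuse.
    move=> /andP[y0 yY]; apply/orthoschemeP => //; split => //.
    + by case/andP: xr => /ltW.
    + by rewrite below_hypotenuse.
    + by apply: le_lt_trans q; rewrite lerD2l ler_pM.
    + by rewrite ltxx.
  - move=> x xr; split; last exact: line_in_disc e0 e1 xr.
    by move: xr; rewrite divr1 mul1r => /andP[]; lra.
  - apply: cvg_strip_area => //.
    + by rewrite expr0n subr0.
    + near=> t; apply: line_in_disc e0 e1 _; apply/andP; split.
        by near: t; exact: nbhs_right_gt.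
      by near: t; exact: nbhs_right_lt.
    + exact: cvg_within.
  - rewrite /strip_area.
    (* Cancelling [sqrt (1 - t)] removes the singularity at 1. *)
    have uE (t : R) : 0 < t -> t < 1 ->
        strip_sine 1 (1 / 1) t = - (Num.sqrt (1 - t) * (Num.sqrt (1 + t))^-1).
      move=> t0 t1; rewrite /strip_sine divr1 mul1r expr1n subrr add0r mulr1.
      have -> : 1 - t ^+ 2 = (1 - t) * (1 + t) by ring.
      rewrite sqrtrM ?subr_ge0 ?ltW//.
      have -> : t - 1 = - Num.sqrt (1 - t) ^+ 2.
        by rewrite sqr_sqrtr ?opprB// subr_ge0 ltW.
      by field; rewrite !gt_eqF// sqrtr_gt0; lra.
    have nt : \forall t \near (1 : R)^'-, 0 < t < 1.
      near=> t; apply/andP; split; near: t; first exact: nbhs_left_gt.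
      exact: nbhs_left_lt.
    apply: cvg_asin.
    + by rewrite u1; apply/andP; split; lra.
    + apply: filterS nt => t t01; apply: strip_sine_bound => //.
        by rewrite subr_gt0 expr_lt1//; lra.
      by apply/ltW; exact: line_in_disc e0 e1 t01.
    + rewrite u1.
      have : - (Num.sqrt (1 - t) * (Num.sqrt (1 + t))^-1) @[t --> (1 : R)^'-] -->
          - (Num.sqrt (1 - 1) * (Num.sqrt (1 + 1))^-1).
        apply: cvgN; apply: cvgM.
          apply: continuous_cvg; first exact: sqrt_continuous.
          by apply: cvgB; [exact: cvg_cst|exact: cvg_within].
        apply: cvgV; first by rewrite gt_eqF// sqrtr_gt0; lra.
        apply: continuous_cvg; first exact: sqrt_continuous.
        by apply: cvgD; [exact: cvg_cst|exact: cvg_within].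
      rewrite subrr sqrtr0 mul0r oppr0; apply: cvg_trans.
      apply: near_eq_cvg; apply: filterS nt => t /andP[t0 t1].
      by rewrite uE.
have u0 : strip_sine 1 (1 / 1) 0 = -1 :> R.
  by rewrite /strip_sine divr1 mulr0 sub0r expr1n expr0n subrr add0r subr0 mulr1 sqrtr1 divr1.
by rewrite AE /strip_area u1 u0 asin0 sub0r asinN ?asin1 ?opprK// lexx; lra.
Unshelve. all: by end_near. Qed.

(** The polar lines meet at [(1/r, 1/h)]. When this point is in the closed disc it also lies on or
    below the edge [P0 P2], which therefore cuts nothing off: the region is a strip under the
    horizontal line [y = 1/h]. *)
Lemma A_box (R : realType) (r h : R) : 1 < r -> 1 < h ->
  r^-1 ^+ 2 + h^-1 ^+ 2 <= 1 ->
  A r h = (asin (strip_sine h^-1 0 r^-1))%:E /\ -1 <= strip_sine h^-1 0 r^-1 <= 1.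
Proof.
move=> r1 h1 rh.
have r0 : 0 < r by lra.
have h0 : 0 < h by lra.
have rV0 : 0 < r^-1 by rewrite invr_gt0.
have rV1 : r^-1 < 1 by rewrite invf_lt1.
have hV0 : 0 < h^-1 by rewrite invr_gt0.
have hV1 : h^-1 < 1 by rewrite invf_lt1.
have D0 : 0 < 1 - h^-1 ^+ 2 + 0 ^+ 2.
  by rewrite expr0n addr0 subr_gt0 expr_lt1// ltW.
have e0 : 0 * 0 + (h^-1 - 0 * 0) * (h^-1 - 0 * 0) <= 1.
  by rewrite !mulr0 add0r subr0 -expr2 expr_le1 ?ltW.
have e1 : r^-1 * r^-1 + (h^-1 - 0 * r^-1) * (h^-1 - 0 * r^-1) <= 1.
  by rewrite mul0r subr0 -!expr2.
split; last first.
  by apply: strip_sine_bound => //; rewrite subr_gt0 expr_lt1// ltW.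
have -> : A r h = (strip_area h^-1 0 r^-1 - strip_area h^-1 0 0)%:E.
  apply: hyp_area_strip_lt1 => //; last 2 first.
  - by rewrite mul0r subr0.
  - by rewrite mul0r subr0 ltW.
  - exact: measurable_orthoscheme.
  - move=> x y /orthoschemeP[//|//|-> y0 xy _ [/(_ r1) xr _]] /=.
    by rewrite -[r^-1]mul1r ler_pdivlMr.
  - move=> x y xr; have q := line_in_disc _ _ _ _ _ _ e0 e1 xr.
    rewrite mul0r subr0 in q *; case/andP: xr => /ltW x0 /ltW xr.
    split.
      move=> /orthoschemeP[//|//|_ -> xy _ [_ /(_ h1) yh]] /=.
      by rewrite -[h^-1]mul1r ler_pdivlMr.
    move=> /andP[y0 yY]; apply/orthoschemeP => //; split => //.
    + apply: le_trans rh; rewrite !expr2 lerD// ler_pM2r//.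
    + by apply: le_lt_trans q; rewrite lerD2l ler_pM.
    + by rewrite -!ler_pdivlMr// !mul1r.
by rewrite /strip_area {2}/strip_sine mulr0 subrr mul0r asin0 subr0.
Qed.

(** The axes, the two polar lines and the edge [P0 P2] bound a pentagon with five right angles,
    whose defect is pi/2. The pentagon is cut by a vertical into a strip under the polar line of
    [P2] and a strip under the edge. *)
Lemma A_pentagon (R : realType) (r h : R) : 1 < r -> 1 < h ->
  1 < r^-1 ^+ 2 + h^-1 ^+ 2 -> A r h = (pi / 2)%:E.
Proof.
move=> r1 h1 rh.
have r0 : 0 < r by lra.
have h0 : 0 < h by lra.
have rn : r != 0 by rewrite gt_eqF.
have hn : h != 0 by rewrite gt_eqF.
have rV0 : 0 < r^-1 by rewrite invr_gt0.
have rV1 : r^-1 < 1 by rewrite invf_lt1.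
have hV0 : 0 < h^-1 by rewrite invr_gt0.
have hV1 : h^-1 < 1 by rewrite invf_lt1.
pose c2 := 1 - h^-1 ^+ 2.
pose b2 := 1 - r^-1 ^+ 2.
have c20 : 0 < c2 by rewrite subr_gt0 expr_lt1// ltW.
have b20 : 0 < b2 by rewrite subr_gt0 expr_lt1// ltW.
(* [e > 0] says that the edge [P0 P2] crosses the disc. *)
pose e := 1 - r ^+ 2 * c2.
have e0 : 0 < e.
  have -> : e = r ^+ 2 * (r^-1 ^+ 2 + h^-1 ^+ 2 - 1) by rewrite /e /c2; field; rewrite ?rn ?hn.
  by rewrite mulr_gt0 ?exprn_gt0// subr_gt0.
(* The abscissa where the edge [P0 P2] meets the polar line [y = 1/h]. *)
pose x0 := r * c2.
have x00 : 0 < x0 by rewrite mulr_gt0.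
have x0r : x0 < r^-1.
  by rewrite -[r^-1]mul1r ltr_pdivlMr// /x0 mulrC mulrA -expr2; move: e0; rewrite /e; lra.
have hx0 : h - h / r * x0 = h^-1.
  by rewrite /x0 /c2; field; rewrite ?rn ?hn.
have hrV : h - h / r * r^-1 = h * b2 by rewrite /b2; field; rewrite ?rn ?hn.
have E0 : 0 * 0 + (h^-1 - 0 * 0) * (h^-1 - 0 * 0) <= 1.
  by rewrite !mulr0 add0r subr0 -expr2 expr_le1 ?ltW.
have x0E : 1 - (x0 ^+ 2 + h^-1 ^+ 2) = c2 * e by rewrite /x0 /e /c2; field; rewrite ?rn ?hn.
have x02 : x0 ^+ 2 + h^-1 ^+ 2 <= 1.
  by rewrite -subr_ge0 x0E mulr_ge0 ?ltW.
have E1 : x0 * x0 + (h^-1 - 0 * x0) * (h^-1 - 0 * x0) <= 1.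
  by rewrite mul0r subr0 -!expr2.
have E1' : x0 * x0 + (h - h / r * x0) * (h - h / r * x0) <= 1.
  by rewrite hx0 -!expr2.
have E2 : r^-1 * r^-1 + (h - h / r * r^-1) * (h - h / r * r^-1) <= 1.
  rewrite hrV -subr_ge0.
  have -> : 1 - (r^-1 * r^-1 + h * b2 * (h * b2)) =
      b2 * (h ^+ 2 * (r^-1 ^+ 2 + h^-1 ^+ 2 - 1)) by rewrite /b2; field; rewrite ?rn ?hn.
  by rewrite !mulr_ge0 ?exprn_ge0 ?(ltW b20) ?(ltW h0)//; lra.
have DK : 0 < 1 - h^-1 ^+ 2 + 0 ^+ 2 by rewrite expr0n addr0.
have DE : 1 - h ^+ 2 + (h / r) ^+ 2 = (h / r) ^+ 2 * e.
  by rewrite /e /c2; field; rewrite ?rn ?hn.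
have DW : 0 < 1 - h ^+ 2 + (h / r) ^+ 2.
  by rewrite DE mulr_gt0 ?exprn_gt0 ?divr_gt0.
have x01 : 0 < 1 - x0 ^+ 2.
  by move: x02 (exprn_gt0 2 hV0); lra.
have mO := measurable_orthoscheme _ _ _ r0 h0.
pose L : set (R * R) := [set p | p.1 <= x0].
have mL : measurable L.
  rewrite -[L]setTI; have : measurable_fun setT (fun p : R * R => p.1 <= x0).
    by apply: measurable_fun_ler => //; exact: measurable_fst.
  by move=> /(_ measurableT [set true] I).
have -> : A r h = (hyp_area (orthoscheme r h `&` L) + hyp_area (orthoscheme r h `&` ~` L))%E.
  rewrite /A /hyp_area -ge0_integral_setU //=.
  - by rewrite -setIUr setUCr setIT.
  - exact: measurableI.
  - by apply: measurableI => //; exact: measurableC.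
  - apply: measurable_funTS; apply/measurable_EFinP; exact: measurable_klein_density.
  - by move=> p _; rewrite lee_fin klein_density_ge0.
  - apply/disj_setPS => p [[_ ?] [_ ?]]; contradiction.
have -> : hyp_area (orthoscheme r h `&` L) =
    (strip_area h^-1 0 x0 - strip_area h^-1 0 0)%:E.
  apply: hyp_area_strip_lt1 => //; last 2 first.
  - by rewrite mul0r subr0.
  - by rewrite mul0r subr0 ltW.
  - exact: measurableI.
  - exact: lt_trans rV1.
  - by move=> x y [/orthoschemeP[//|//|-> y0 xy _ _]].
  - move=> x y xr; have q := line_in_disc _ _ _ _ _ _ E0 E1 xr.
    rewrite mul0r subr0 in q *; case/andP: xr => x_0 xr.
    split.
      move=> [/orthoschemeP[//|//|_ -> xy _ [_ /(_ h1) yh]] _] /=.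
      by rewrite -[h^-1]mul1r ler_pdivlMr.
    move=> /andP[y0 yY]; split; last exact: ltW.
    apply/orthoschemeP => //; split => //; first exact: ltW.
    + rewrite below_hypotenuse//; apply: le_trans yY _; rewrite -hx0 lerD2l lerN2.
      by rewrite ler_pM2l ?divr_gt0// ltW.
    + by apply: le_lt_trans q; rewrite lerD2l ler_pM.
    + by rewrite -!ler_pdivlMr// !mul1r; split => // _; apply/ltW/(lt_trans xr).
have -> : hyp_area (orthoscheme r h `&` ~` L) =
    (strip_area h (h / r) r^-1 - strip_area h (h / r) x0)%:E.
  apply: hyp_area_strip_lt1 => //.
  - by apply: measurableI => //; exact: measurableC.
  - exact: ltW.
  - move=> x y [/orthoschemeP[//|//|_ y0 xy _ [/(_ r1) xr _]]] /negP.
    by rewrite /= -ltNge => /ltW ->; rewrite -[r^-1]mul1r ler_pdivlMr.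
  - move=> x y xr; have q := line_in_disc _ _ _ _ _ _ E1' E2 xr.
    case/andP: xr => x_0 xr.
    split.
      by move=> [/orthoschemeP[//|//|_ -> xy _ _] _] /=; rewrite -below_hypotenuse.
    move=> /andP[y0 yY]; split; last by apply/negP; rewrite -ltNge.
    apply/orthoschemeP => //; split => //; first by apply/ltW/(lt_trans x00).
    + by rewrite below_hypotenuse.
    + by apply: le_lt_trans q; rewrite lerD2l ler_pM.
    + rewrite -!ler_pdivlMr// !mul1r; split => _; first exact: ltW.
      apply: le_trans yY _; rewrite -hx0 lerD2l lerN2.
      by rewrite ler_pM2l ?divr_gt0// ltW.
  - by rewrite hx0.
  - by rewrite hrV mulr_ge0// ltW.
rewrite -EFinD; congr EFin; rewrite /strip_area.
(* The corners on the outer verticals are right angles and contribute nothing; only the two angles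
   at the cut remain. *)
have -> : strip_sine h^-1 0 0 = 0 by rewrite /strip_sine mulr0 subrr mul0r.
have -> : strip_sine h (h / r) r^-1 = 0 by rewrite /strip_sine subrr mul0r.
rewrite asin0 subr0 sub0r.
have wN : h * x0 - h / r = - (h / r * e) by rewrite /x0 /e; field; rewrite ?rn ?hn.
have w0 : 0 < h / r * e by rewrite mulr_gt0 ?divr_gt0.
rewrite -asinN; last exact: strip_sine_bound.
apply: asinD_pihalf.
- by rewrite divr_ge0 ?sqrtr_ge0// subr0 mulr_ge0 ?ltW.
- by rewrite /strip_sine wN mulNr opprK divr_ge0// ltW.
have cn : c2 != 0 by rewrite gt_eqF.
have en : e != 0 by rewrite gt_eqF.
have xn : 1 - x0 ^+ 2 != 0 by rewrite gt_eqF.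
(* With [q = e / (1 - x0^2)], the squares of the two sines are [1 - q] and [q]. *)
have := sqr_strip_sine _ _ _ _ DK x01.
rewrite mul0r subr0 expr0n addr0 -addrA -opprD x0E -/c2.
have -> : c2 * e / ((1 - x0 ^+ 2) * c2) = e / (1 - x0 ^+ 2) by field; rewrite xn.
have := sqr_strip_sine _ _ _ _ DW x01.
rewrite hx0 -addrA -opprD x0E DE.
have -> : c2 * e / ((1 - x0 ^+ 2) * ((h / r) ^+ 2 * e)) = 1 - e / (1 - x0 ^+ 2).
  have ce : 1 - x0 ^+ 2 - e = c2 * r ^+ 2 / h ^+ 2.
    by rewrite /x0 /e /c2; field.
  have -> : 1 - e / (1 - x0 ^+ 2) = (1 - x0 ^+ 2 - e) / (1 - x0 ^+ 2) by field.
  by rewrite ce; field; rewrite rn hn en xn.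
by rewrite sqrrN => W K; lra.
Qed.

(** * Comparison with the area at [h = 1] *)

(** Up to [h = 1] there is no truncation at [P2], so the region grows with [h]. *)
Lemma A_le_ideal (R : realType) (r h : R) : 0 < r -> 0 < h -> h <= 1 ->
  (A r h <= A r 1)%E.
Proof.
move=> r0 h0 h1; apply: ge0_subset_integral.
- exact: measurable_orthoscheme.
- exact: measurable_orthoscheme.
- apply: measurable_funTS; apply/measurable_EFinP; exact: measurable_klein_density.
- by move=> p _; rewrite lee_fin klein_density_ge0.
- move=> -[x y] /orthoschemeP[//|//|x0 y0 xy xy1 [xr _]]; apply/orthoschemeP => //.
  split => //; last by rewrite ltxx.
  by apply: le_trans xy; rewrite lerD2l divr1 ler_peMr// invf_ge1.
Qed.

Lemma strip_density_lt (R : realType) (h m h' m' x : R) :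
  0 < h - m * x -> h - m * x < h' - m' * x ->
  x * x + (h' - m' * x) * (h' - m' * x) < 1 ->
  strip_density h m x < strip_density h' m' x.
Proof.
rewrite /strip_density; set Y := h - m * x; set Z := h' - m' * x.
move=> Y0 YZ xZ; have Z0 := lt_trans Y0 YZ.
have YZ2 : Y ^+ 2 < Z ^+ 2 by rewrite ltr_pXn2r// nnegrE ltW.
have sZ : 0 < 1 - x ^+ 2 - Z ^+ 2 by rewrite !expr2; lra.
have sY : 0 < 1 - x ^+ 2 - Y ^+ 2 by lra.
have x1 : 0 < 1 - x ^+ 2 by have := sqr_ge0 Y; lra.
rewrite ltr_pM// ?(ltW Y0) ?invr_ge0 ?mulr_ge0 ?sqrtr_ge0 ?(ltW x1)//.
rewrite ltf_pV2 ?posrE ?mulr_gt0 ?sqrtr_gt0// ltr_pM2l// ltr_sqrt//; lra.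
Qed.

(** Inclusion of the regions gives only a weak inequality. Strictness comes from the mean value
    theorem for the difference of the two strip areas, whose derivative is positive since the height
    [k (1 - z / r)] increases with [k]. *)
Lemma A_proper_lt_ideal (R : realType) (r h : R) : 0 < r -> r < 1 -> 0 < h -> h < 1 ->
  (A r h < A r 1)%E.
Proof.
move=> r0 r1 h0 h1; rewrite !A_triangle ?(ltW h1)// lte_fin.
have rr (k : R) : k / r * r = k by rewrite divfK ?gt_eqF.
have e0 (k : R) : 0 < k -> k <= 1 ->
    0 * 0 + (k - k / r * 0) * (k - k / r * 0) <= 1.
  by move=> k0 k1; rewrite !mulr0 add0r subr0 -expr2 expr_le1// ltW.
have e1 (k : R) : r * r + (k - k / r * r) * (k - k / r * r) <= 1.
  by rewrite rr subrr mulr0 addr0 -expr2 expr_le1// ltW.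
have D0 (k : R) : 0 < k -> k <= 1 -> 0 < 1 - k ^+ 2 + (k / r) ^+ 2.
  by move=> *; exact: hypotenuse_gt0.
have c (k : R) : 0 < k -> k <= 1 -> {within `[0, r], continuous (strip_area k (k / r))}.
  by move=> k0 k1; apply: continuous_strip_area => //; auto.
have d (k : R) x : 0 < k -> k <= 1 -> x \in `]0, r[ ->
    is_derive x 1 (strip_area k (k / r)) (strip_density k (k / r) x).
  move=> k0 k1; rewrite in_itv/= => x0; apply: is_derive_strip_area; first by auto.
  exact: line_in_disc (e0 _ k0 k1) (e1 k) x0.
pose F x := strip_area 1 (1 / r) x - strip_area h (h / r) x.
have dF x : x \in `]0, r[ ->
    is_derive x 1 F (strip_density 1 (1 / r) x - strip_density h (h / r) x).
  by move=> xr; apply: is_deriveB; apply: d => //; exact: ltW.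
have cF : {within `[0, r], continuous F}.
  by move=> x; apply: cvgB; apply: c => //; exact: ltW.
have [z zr FE] := MVT r0 dF cF.
suff : 0 < F r - F 0 by rewrite /F; lra.
rewrite FE subr0 mulr_gt0// subr_gt0.
move: zr; rewrite in_itv/= => zr.
have Z : 0 < 1 - z / r by rewrite subr_gt0 ltr_pdivrMr// mul1r; case/andP: zr.
have YE (k : R) : k - k / r * z = k * (1 - z / r) by ring.
apply: strip_density_lt.
- by rewrite YE mulr_gt0.
- by rewrite !YE ltr_pM2r.
- exact: line_in_disc (e0 _ ltr01 (lexx 1)) (e1 1) zr.
Qed.

(** The ideal corner [P2] contributes pi/2 and the corner [P0] contributes minus the arcsine of
    [sqrt (1 - r^2)], which is complementary to [asin r]. *)
Lemma A_ideal_lt1 (R : realType) (r : R) : 0 < r -> r < 1 -> A r 1 = (asin r)%:E.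
Proof.
move=> r0 r1; rewrite A_triangle// /strip_area.
have q0 : 0 < 1 - r ^+ 2 by rewrite subr_gt0 expr_lt1// ltW.
have s0 : 0 < Num.sqrt (1 - r ^+ 2) by rewrite sqrtr_gt0.
have s2 := sqr_sqrtr (ltW q0).
have rV0 : 0 < r^-1 by rewrite invr_gt0.
have u0 : strip_sine 1 (1 / r) 0 = -1.
  rewrite /strip_sine mulr0 sub0r expr0n expr1n subr0 subrr add0r !mul1r.
  by rewrite sqrtr_sqr ger0_norm ?ltW// mulNr mulfV// gt_eqF.
have u1 : strip_sine 1 (1 / r) r = - Num.sqrt (1 - r ^+ 2).
  rewrite /strip_sine expr1n subrr add0r !mul1r sqrtrM ?(ltW q0)//.
  rewrite sqrtr_sqr ger0_norm ?ltW//.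
  have -> : r - r^-1 = - (Num.sqrt (1 - r ^+ 2) ^+ 2 / r).
    by rewrite s2; field; rewrite gt_eqF.
  by field; rewrite !gt_eqF.
have s1 : -1 <= Num.sqrt (1 - r ^+ 2) <= 1.
  have : Num.sqrt (1 - r ^+ 2) <= 1.
    by rewrite -(@expr_le1 _ 2) ?(ltW s0)// s2; have := sqr_ge0 r; lra.
  by move=> ?; apply/andP; split; lra.
rewrite u0 u1 !asinN//; last by apply/andP; split; lra.
have := asinD_pihalf _ _ _ (ltW r0) (ltW s0).
by rewrite s2 addrC subrK asin1 => /(_ erefl) ?; congr EFin; lra.
Qed.

Lemma angle_at_P0_ideal (R : realType) (r : R) : 0 < r -> r < 1 ->
  angle_at_P0 r 1 = acos r.
Proof.
move=> r0 r1.
have q0 : 0 < 1 - r ^+ 2 by rewrite subr_gt0 expr_lt1// ltW.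
have qn : 1 - r ^+ 2 != 0 by rewrite gt_eqF.
rewrite /angle_at_P0 /klein_angle /klein_metric /dot2 /P0 /P1 /P2 /=.
congr acos; rewrite !(mul0r, mulr0, addr0, add0r, subr0, sub0r, oppr0) -[r * r]expr2.
(* This value is both the metric product of the two edge directions and the squared length of the
   one along the axis: they differ by the vertical vector, orthogonal to the axis. *)
have -> : - r * - r / (1 - r ^+ 2) + r * - r * (r * - r) / (1 - r ^+ 2) ^+ 2 =
    r ^+ 2 / (1 - r ^+ 2) ^+ 2 by field.
have -> : (- r * - r + 1 * 1) / (1 - r ^+ 2) +
    r * - r * (r * - r) / (1 - r ^+ 2) ^+ 2 = 1 / (1 - r ^+ 2) ^+ 2 by field.
have -> : r ^+ 2 / (1 - r ^+ 2) ^+ 2 * (1 / (1 - r ^+ 2) ^+ 2) =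
    (r / (1 - r ^+ 2) ^+ 2) ^+ 2 by field.
rewrite sqrtr_sqr ger0_norm ?divr_ge0 ?exprn_ge0 ?ltW//.
by field; rewrite qn gt_eqF.
Qed.

Lemma A_ideal_gt1 (R : realType) (r : R) : 1 < r -> A r 1 = (pi / 2)%:E.
Proof.
move=> r1; rewrite A_truncated_left// expr1n subrr add0r sqrtr_sqr.
have r0 : 0 < r by lra.
by rewrite ger0_norm ?divr_ge0 ?(ltW r0)// divff ?asin1// gt_eqF ?divr_gt0.
Qed.

Lemma A_ultraideal_lt_ideal (R : realType) (r h : R) : 0 < r -> r < 1 -> 1 < h ->
  (A r h < A r 1)%E.
Proof.
move=> r0 r1 h1; have h0 : 0 < h by lra.
rewrite A_ideal_lt1// A_sym// A_truncated_left// ?(ltW r1)// lte_fin.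
have hV0 : 0 < h^-1 by rewrite invr_gt0.
have hV1 : h^-1 ^+ 2 < 1 by rewrite expr_lt1 ?invf_lt1// ltW.
have r2 : r ^+ 2 < 1 by rewrite expr_lt1// ltW.
(* After the swap of [r] and [h], the argument of [asin] is [r] times [1/h] over a root; it is below
   [r] because the root exceeds [1/h]. *)
have hD : h^-1 ^+ 2 < 1 - r ^+ 2 + (r / h) ^+ 2.
  rewrite -subr_gt0 [ltRHS](_ : _ = (1 - r ^+ 2) * (1 - h^-1 ^+ 2)); last by ring.
  by rewrite mulr_gt0 ?subr_gt0.
have D0 := lt_trans (exprn_gt0 2 hV0) hD.
have s0 : 0 < Num.sqrt (1 - r ^+ 2 + (r / h) ^+ 2) by rewrite sqrtr_gt0.
have ur : r / h / Num.sqrt (1 - r ^+ 2 + (r / h) ^+ 2) < r.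
  rewrite ltr_pdivrMr// ltr_pM2l// -(@ltr_pXn2r _ 2)// ?nnegrE ?ltW//.
  by rewrite sqr_sqrtr// ltW.
have u0 : 0 < r / h / Num.sqrt (1 - r ^+ 2 + (r / h) ^+ 2) by rewrite !divr_gt0.
by apply: lt_asin => //; apply/andP; split; lra.
Qed.

Theorem theorem2 (R : realType) (r : R) (hr : 0 < r) :
  [/\ (r < 1 ->
        [/\ (forall h : R, 0 < h -> (A r h <= A r 1)%E),
            (forall h : R, 0 < h -> A r h = A r 1 -> h = 1) &
            A r 1 = (pi / 2 - angle_at_P0 r 1)%:E]),
      (r = 1 ->
        (forall h : R, 0 < h -> (A r h <= (pi / 2)%:E)%E) /\
        (forall h : R, 1 <= h -> A r h = (pi / 2)%:E)) &
      (1 < r ->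
        (forall h : R, 0 < h -> (A r h <= (pi / 2)%:E)%E) /\
        (forall h : R, 1 <= h <= r / Num.sqrt (r ^+ 2 - 1) -> A r h = (pi / 2)%:E))].
Proof.
split.
- move=> r1; split.
  + move=> h h0; have [h1|h1] := leP h 1; first exact: A_le_ideal.
    exact/ltW/A_ultraideal_lt_ideal.
  + move=> h h0 AE; have [h1|h1|//] := ltgtP h 1.
      by have := A_proper_lt_ideal _ _ _ hr r1 h0 h1; rewrite AE ltxx.
    by have := A_ultraideal_lt_ideal _ _ _ hr r1 h1; rewrite AE ltxx.
  + rewrite A_ideal_lt1// angle_at_P0_ideal// asin_acos//.
    by apply/andP; split; lra.
- move=> {hr}->.
  have E h : 1 <= h -> A 1 h = (pi / 2 : R)%:E.
    rewrite le_eqVlt => /orP[/eqP <-|h1]; first exact: A_ideal_ideal.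
    (* By symmetry the ideal vertex moves to [P2] and the ultraideal one to [P0]. *)
    by rewrite A_sym ?A_ideal_gt1//; lra.
  split=> // h h0; have [h1|/ltW/E -> //] := leP h 1.
  by rewrite -A_ideal_ideal; exact: A_le_ideal.
- move=> r1.
  have rV1 : r^-1 ^+ 2 < 1 by rewrite expr_lt1 ?invf_lt1 ?invr_ge0// ltW.
  split=> h.
    move=> h0; have [h1|h1] := leP h 1.
      by rewrite -(A_ideal_gt1 _ _ r1); exact: A_le_ideal.
    (* The cases are whether or not the polar lines meet in the closed disc. *)
    have [rh|rh] := leP (r^-1 ^+ 2 + h^-1 ^+ 2) 1; last by rewrite A_pentagon.
    have [-> u1] := A_box _ _ _ r1 h1 rh.
    by rewrite lee_fin asin_lepi2.
  move=> /andP[]; rewrite le_eqVlt => /orP[/eqP <- _|h1 hle]; first exact: A_ideal_gt1.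
  have h0 : 0 < h by lra.
  have r21 : 0 < r ^+ 2 - 1 by rewrite subr_gt0 expr_gt1// ltW.
  (* The upper bound on [h] means that the polar lines do not meet in the open disc. *)
  have rh : 1 <= r^-1 ^+ 2 + h^-1 ^+ 2.
    have s0 : 0 < Num.sqrt (r ^+ 2 - 1) by rewrite sqrtr_gt0.
    move: hle; rewrite ler_pdivlMr// => /(lerXn2r 2).
    rewrite !nnegrE mulr_ge0 ?(ltW hr) ?(ltW h0) ?(ltW s0)// => /(_ isT isT).
    rewrite exprMn sqr_sqrtr ?(ltW r21)// -subr_ge0 => H.
    rewrite -subr_ge0.
    have -> : r^-1 ^+ 2 + h^-1 ^+ 2 - 1 =
        (r ^+ 2 - h ^+ 2 * (r ^+ 2 - 1)) / (r ^+ 2 * h ^+ 2).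
      by field; rewrite !gt_eqF.
    by rewrite divr_ge0// mulr_ge0// exprn_ge0// ltW.
  (* At the right end of the range of [h] the polar lines meet at an ideal point: the box formula
     holds and its sine is 1. *)
  move: rh; rewrite le_eqVlt => /orP[/eqP rh|]; last exact: A_pentagon.
  have [-> u1] := A_box _ _ _ r1 h1 (eq_ind_r (fun x => x <= 1) (lexx 1) (esym rh)).
  have hV1 : h^-1 ^+ 2 < 1 by rewrite expr_lt1 ?invf_lt1 ?invr_ge0// ltW.
  suff -> : strip_sine h^-1 0 r^-1 = 1 by rewrite asin1.
  have u0 : 0 <= strip_sine h^-1 0 r^-1.
    by rewrite divr_ge0 ?sqrtr_ge0// subr0 mulr_ge0 ?invr_ge0 ?ltW.
  apply/eqP; rewrite -(@eqrXn2 _ 2)// expr1n -subr_eq0 -oppr_eq0 opprB.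
  rewrite sqr_strip_sine ?subr_gt0//; last by rewrite expr0n addr0 subr_gt0.
  by rewrite mul0r subr0 -addrA -opprD -rh subrr mul0r.
Qed.
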